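(* The class $\mathrm{RAND}_{\mathrm{Schnorr}}$ of Schnorr random sequences is a $\Pi^0_3$-class, but not a $\boldsymbol\Sigma^0_3$-class.
   Context: $\mathbf{C}=\{0,1\}^{\mathbb N}$; $A\upharpoonright n$ is the first $n$ bits of $A$. A martingale is $d:\{0,1\}^*\to[0,\infty)$ with $2d(w)=d(w0)+d(w1)$ for all $w$. An order is an unbounded nondecreasing function $h:\mathbb N\to\mathbb N$. $S^h[d]=\{A\in\mathbf C:\limsup_n d(A\upharpoonright n)/h(n)\ge1\}$. $A$ is Schnorr random if $A\notin S^h[d]$ for every computable martingale $d$ and every computable order $h$ (equivalently, $\{A\}$ is not covered by any Schnorr test: a uniformly c.e. sequence of open sets $\mathcal U_i$ with $\mu(\mathcal U_i)=2^{-i}$). $\Pi^0_3$ refers to the lightface arithmetical hierarchy of subsets of $\mathbf C$; $\boldsymbol\Sigma^0_3$ is the Borel class of countable unions of $G_\delta$ sets. *)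

(* Defs.v *)
From mathcomp Require Import all_boot all_order all_algebra.
From mathcomp Require Import all_classical all_reals all_analysis borel_hierarchy.
From Stdlib Require Arith.Cantor.

Set Implicit Arguments.
Unset Strict Implicit.
Unset Printing Implicit Defensive.

Import Order.TTheory GRing.Theory Num.Theory.
Import numFieldNormedType.Exports.

Local Open Scope classical_set_scope.
Local Open Scope ring_scope.

(* Partial recursive functions, in their one-argument form: several arguments
   are passed through the Cantor pairing function of the standard library. *)
Definition npair (x y : nat) : nat := Arith.Cantor.to_nat (x, y).

Inductive recfun : Type :=
| RZero
| RSucc
| RLeft
| RRight
| RPair of recfun & recfun
| RComp of recfun & recfun
| RPrec of recfun & recfun
| RMu of recfun.

(* [reval c x y]: the partial function with program [c] is defined at [x], with
   value [y]. For [RPrec], [s] lists the successive values of the recursion.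
   For [RMu], [f] must be defined, and nonzero, at every argument below [y]. *)
Fixpoint reval (c : recfun) (x y : nat) : Prop :=
  match c with
  | RZero => y = 0%N
  | RSucc => y = x.+1
  | RLeft => y = (Arith.Cantor.of_nat x).1
  | RRight => y = (Arith.Cantor.of_nat x).2
  | RPair f g => exists u v, [/\ reval f x u, reval g x v & y = npair u v]
  | RComp f g => exists2 u, reval g x u & reval f u y
  | RPrec f g =>
      let: (a, n) := Arith.Cantor.of_nat x in
      exists s : nat -> nat,
        [/\ reval f a (s 0%N),
            forall i, (i < n)%N -> reval g (npair a (npair i (s i))) (s i.+1)
          & y = s n]
  | RMu f =>
      reval f (npair x y) 0%N /\
      forall m, (m < y)%N -> exists k, reval f (npair x m) k.+1
  end.

(* The length-lexicographic bijection between binary strings and numbers: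
   the empty string, 0, 1, 00, 01, ... are sent to 0, 1, 2, 3, 4, ... *)
Definition str_code (w : seq bool) : nat :=
  foldl (fun m (b : bool) => (m.*2 + b.+1)%N) 0%N w.

Definition computable_nat (f : nat -> nat) : Prop :=
  exists c, forall n, reval c n (f n).

Definition computable_str_nat (f : seq bool -> nat -> nat) : Prop :=
  exists c, forall w n, reval c (npair (str_code w) n) (f w n).

Definition computable_rel (P : nat -> nat -> seq bool -> bool) : Prop :=
  exists c, forall i j w,
    reval c (npair i (npair j (str_code w))) (nat_of_bool (P i j w)).

Definition restr (A : cantor_space) (n : nat) : seq bool := mkseq A n.

Section Martingales.
Context {R : realType}.

Definition martingale (d : seq bool -> R) : Prop :=
  (forall w, 0 <= d w) /\
  (forall w, 2 * d w = d (rcons w false) + d (rcons w true)).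

(* The values of [d] are uniformly approximated within [2 ^- n] by computable
   nonnegative rationals [p / (q + 1)]; [d] is meant to be nonnegative. *)
Definition computable_real_fun (d : seq bool -> R) : Prop :=
  exists p q : seq bool -> nat -> nat,
    [/\ computable_str_nat p, computable_str_nat q &
        forall w n, `|d w - (p w n)%:R / (q w n).+1%:R| <= 2 ^- n].

Definition order_fun (h : nat -> nat) : Prop :=
  {homo h : m n / (m <= n)%N} /\ (forall b, exists n, (b < h n)%N).

(* An order vanishes at finitely many arguments only, so that the value given
   to a division by zero does not influence the limit superior. *)
Definition success_set (h : nat -> nat) (d : seq bool -> R)
    : set cantor_space :=
  [set A | (1%:E <= limn_esup (fun n => (d (restr A n) / (h n)%:R)%:E))%E].

End Martingales.

Definition schnorr_random (R : realType) : set cantor_space :=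
  [set A | forall (d : seq bool -> R) (h : nat -> nat),
     martingale d -> computable_real_fun d ->
     order_fun h -> computable_nat h ->
     ~ success_set h d A].

(* Intersections, over i, of unions, over j, of uniformly Pi^0_1 classes, where a
   Pi^0_1 class consists of the sequences all of whose initial segments satisfy
   a computable predicate. *)
Definition lightface_Pi03 (X : set cantor_space) : Prop :=
  exists2 P : nat -> nat -> seq bool -> bool, computable_rel P &
    X = [set A | forall i, exists j, forall k, P i j (restr A k)].

Definition boldface_Sigma03 (X : set cantor_space) : Prop :=
  exists2 G : (set cantor_space)^nat,
    (forall i, Gdelta (G i)) & X = \bigcup_i G i.

(* Main.v *)
(** Upper bound. A real-valued martingale is represented by integers a(w,n) with
    |2^n d(w) - a(w,n)| <= 2. A universal step-bounded simulator of [recfun] lets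
    one quantify over all programs i computing a pair (a, h); program i imposes no
    constraint on A exactly when it is not total, or violates one of the closed
    conditions expressing that a approximates a martingale and that h is
    monotone, or h is bounded; otherwise A must satisfy d(A|n) <= r/(r+1) h(n) for
    all n >= N, for some N and r. Each alternative has the form "exists j, forall k".

    Lower bound. Suppose the class is a union of G_delta sets G_k, and list the
    computable martingales as e_k. One builds A together with a finite weighted sum
    D of the e_k which stays below 1 along A. Given D, some finite extension of
    the current prefix forces A out of G_k as long as D stays below 1: otherwise a
    Baire category construction yields a point of G_k on which arbitrarily long
    stretches of bits minimise D greedily, and betting on the
    greedy bit is a computable martingale which succeeds on that point. Then a
    small multiple of e_k is added to D. The limit A is random, as every e_k is
    bounded along A, but is in no G_k. *)
Require Import Defs.
From mathcomp Require Import all_boot all_order all_algebra.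
From mathcomp Require Import all_classical all_reals all_analysis borel_hierarchy.
From mathcomp Require Import zify ring lra.
From Stdlib Require Cantor.

Set Implicit Arguments.
Unset Strict Implicit.
Unset Printing Implicit Defensive.

(** * Closure properties of computable functions *)

Definition un1 (z : nat) : nat := (Cantor.of_nat z).1.
Definition un2 (z : nat) : nat := (Cantor.of_nat z).2.

Lemma un1K x y : un1 (npair x y) = x.
Proof. by rewrite /un1 /npair Cantor.cancel_of_to. Qed.

Lemma un2K x y : un2 (npair x y) = y.
Proof. by rewrite /un2 /npair Cantor.cancel_of_to. Qed.

Lemma npairK z : npair (un1 z) (un2 z) = z.
Proof. by rewrite /npair /un1 /un2 -surjective_pairing Cantor.cancel_to_of. Qed.

Lemma npair_ge x y : x + y <= npair x y.
Proof. by have := Cantor.to_nat_non_decreasing x y; rewrite /npair; lia. Qed.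

Definition unK := (un1K, un2K).

Lemma reval_prec f g x y : reval (RPrec f g) x y <->
  exists s : nat -> nat, [/\ reval f (un1 x) (s 0),
    forall i, i < un2 x -> reval g (npair (un1 x) (npair i (s i))) (s i.+1)
    & y = s (un2 x)].
Proof. by rewrite /un1 /un2 /=; case: Cantor.of_nat. Qed.

Lemma un1_0 : un1 0 = 0.
Proof. by []. Qed.

Global Opaque npair un1 un2.

Lemma comp_id : computable_nat id.
Proof.
by exists (RPair RLeft RRight) => x /=; exists (un1 x), (un2 x); rewrite npairK.
Qed.

Lemma comp_comp f g :
  computable_nat f -> computable_nat g -> computable_nat (fun x => f (g x)).
Proof. by move=> [c Hc] [e He]; exists (RComp c e) => x /=; exists (g x). Qed.

Lemma comp_const k : computable_nat (fun=> k).
Proof.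
elim: k => [|k [c Hc]]; first by exists RZero.
by exists (RComp RSucc c) => x /=; exists k.
Qed.

Lemma comp_succ f : computable_nat f -> computable_nat (fun x => (f x).+1).
Proof. by move=> [c Hc]; exists (RComp RSucc c) => x /=; exists (f x). Qed.

Lemma comp_un1 f : computable_nat f -> computable_nat (fun x => un1 (f x)).
Proof. by move=> [c Hc]; exists (RComp RLeft c) => x /=; exists (f x). Qed.

Lemma comp_un2 f : computable_nat f -> computable_nat (fun x => un2 (f x)).
Proof. by move=> [c Hc]; exists (RComp RRight c) => x /=; exists (f x). Qed.

Lemma comp_npair f g : computable_nat f -> computable_nat g ->
  computable_nat (fun x => npair (f x) (g x)).
Proof.
by move=> [c Hc] [e He]; exists (RPair c e) => x /=; exists (f x), (g x).
Qed.

(** All bounded loops below reduce to this form: the parameter [x], the index and the accumulator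
    reach the step function as nested pairs. *)
Lemma comp_natrec (a : nat -> nat) (g : nat -> nat -> nat -> nat) (n : nat -> nat) :
  computable_nat a ->
  computable_nat (fun z => g (un1 z) (un1 (un2 z)) (un2 (un2 z))) ->
  computable_nat n ->
  computable_nat (fun x => nat_rect (fun=> nat) (a x) (g x) (n x)).
Proof.
move=> [ca Ha] [cg Hg] /(comp_npair comp_id) [cn Hn].
exists (RComp (RPrec ca cg) cn) => x; exists (npair x (n x)); first exact: Hn.
apply/reval_prec; exists (nat_rect (fun=> nat) (a x) (g x)); rewrite !unK; split=> // i _.
by have := Hg (npair x (npair i (nat_rect (fun=> nat) (a x) (g x) i))); rewrite !unK.
Qed.

Lemma comp_if (b : nat -> bool) f g : computable_nat (fun x => b x) ->
  computable_nat f -> computable_nat g ->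
  computable_nat (fun x => if b x then f x else g x).
Proof.
move=> hb hf hg.
(* A recursion of length [b x], that is 0 or 1: it starts at [g x], and its only possible step
   overwrites the value with [f x]. *)
have := @comp_natrec g (fun x _ _ => f x) (fun x => b x) hg (comp_comp hf (comp_un1 comp_id)) hb.
by rewrite (_ : (fun _ => _) = (fun x => if b x then f x else g x)) //;
  apply/funext => x; case: (b x).
Qed.

Lemma comp_search (b : nat -> nat -> bool) f :
  computable_nat (fun z => b (un1 z) (un2 z)) ->
  (forall x, b x (f x)) -> (forall x m, m < f x -> ~~ b x m) -> computable_nat f.
Proof.
move=> hb bf bm.
(* [RMu] stops at the first zero, so truth is sent to 0 and falsity to 1. *)
have [c Hc] := comp_if hb (comp_const 0) (comp_const 1).
exists (RMu c) => x /=; split=> [|m /bm bxm].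
  by have := Hc (npair x (f x)); rewrite !unK bf.
by exists 0; have := Hc (npair x m); rewrite !unK (negbTE bxm).
Qed.

Lemma comp_add f g : computable_nat f -> computable_nat g ->
  computable_nat (fun x => f x + g x).
Proof.
move=> hf hg; have := @comp_natrec f (fun _ _ s => s.+1) g
  hf (comp_succ (comp_un2 (comp_un2 comp_id))) hg.
rewrite (_ : (fun _ => _) = (fun x => f x + g x)) //.
by apply/funext => x; elim: (g x) => [|n /= ->]; rewrite ?addn0 ?addnS.
Qed.

Lemma comp_mul f g : computable_nat f -> computable_nat g ->
  computable_nat (fun x => f x * g x).
Proof.
move=> hf hg; have := @comp_natrec (fun=> 0) (fun x _ s => s + f x) g (comp_const 0)
  (comp_add (comp_un2 (comp_un2 comp_id)) (comp_comp hf (comp_un1 comp_id))) hg.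
rewrite (_ : (fun _ => _) = (fun x => f x * g x)) //.
by apply/funext => x; elim: (g x) => [|n /= ->]; rewrite ?muln0 // mulnS addnC.
Qed.

Lemma comp_exp f g : computable_nat f -> computable_nat g ->
  computable_nat (fun x => f x ^ g x).
Proof.
move=> hf hg; have := @comp_natrec (fun=> 1) (fun x _ s => s * f x) g (comp_const 1)
  (comp_mul (comp_un2 (comp_un2 comp_id)) (comp_comp hf (comp_un1 comp_id))) hg.
rewrite (_ : (fun _ => _) = (fun x => f x ^ g x)) //.
by apply/funext => x; elim: (g x) => [|n /= ->]; rewrite ?expn0 // expnS mulnC.
Qed.

Lemma comp_pred f : computable_nat f -> computable_nat (fun x => (f x).-1).
Proof.
move=> hf; have := @comp_natrec (fun=> 0) (fun _ i _ => i) f (comp_const 0)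
  (comp_un1 (comp_un2 comp_id)) hf.
by rewrite (_ : (fun _ => _) = (fun x => (f x).-1)) //; apply/funext => x; case: (f x).
Qed.

Lemma comp_sub f g : computable_nat f -> computable_nat g ->
  computable_nat (fun x => f x - g x).
Proof.
move=> hf hg; have := @comp_natrec f (fun _ _ s => s.-1) g hf
  (comp_pred (comp_un2 (comp_un2 comp_id))) hg.
rewrite (_ : (fun _ => _) = (fun x => f x - g x)) //.
by apply/funext => x; elim: (g x) => [|n /= ->]; rewrite ?subn0 ?subnS.
Qed.

Lemma comp_eq0 f : computable_nat f -> computable_nat (fun x => f x == 0).
Proof.
move=> hf; have := comp_sub (comp_const 1) hf.
by rewrite (_ : (fun _ => _) = (fun x => nat_of_bool (f x == 0))) //;
  apply/funext => x; case: (f x) => // -[].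
Qed.

Lemma comp_leq f g : computable_nat f -> computable_nat g ->
  computable_nat (fun x => f x <= g x).
Proof. by move=> hf hg; apply: comp_eq0 (comp_sub hf hg). Qed.

Lemma comp_negb (b : nat -> bool) : computable_nat (fun x => b x) ->
  computable_nat (fun x => ~~ b x).
Proof.
move=> hb; have := comp_eq0 hb.
by rewrite (_ : (fun _ => _) = (fun x => nat_of_bool (~~ b x))) //;
  apply/funext => x; case: (b x).
Qed.

Lemma comp_ifb (b c e : nat -> bool) : computable_nat (fun x => b x) ->
  computable_nat (fun x => c x) -> computable_nat (fun x => e x) ->
  computable_nat (fun x => if b x then c x else e x).
Proof.
move=> hb hc he; have := comp_if hb hc he.
by rewrite (_ : (fun _ => _) = (fun x => nat_of_bool (if b x then c x else e x))) //;
  apply/funext => x; case: (b x).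
Qed.

Lemma comp_eqn f g : computable_nat f -> computable_nat g ->
  computable_nat (fun x => f x == g x).
Proof.
move=> hf hg; have := comp_ifb (comp_leq hf hg) (comp_leq hg hf) (comp_const false).
by under [X in computable_nat X -> _]funext => x do rewrite -[if _ then _ else _]/(_ && _) -eqn_leq.
Qed.

Lemma comp_divS f g : computable_nat f -> computable_nat g ->
  computable_nat (fun x => f x %/ (g x).+1).
Proof.
move=> hf hg; apply: (@comp_search (fun x k => f x < k.+1 * (g x).+1)).
- apply: comp_leq; first exact: comp_succ (comp_comp hf (comp_un1 comp_id)).
  apply: comp_mul; first exact: comp_succ (comp_un2 comp_id).
  exact: comp_succ (comp_comp hg (comp_un1 comp_id)).
- by move=> x; rewrite -ltn_divLR.
- by move=> x m; rewrite -leqNgt -leq_divRL.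
Qed.

Lemma comp_iter (F : nat -> nat) n a : computable_nat F -> computable_nat n ->
  computable_nat a -> computable_nat (fun x => iter (n x) F (a x)).
Proof.
move=> hF hn ha.
exact: (@comp_natrec a (fun _ _ s => F s) n ha (comp_comp hF (comp_un2 (comp_un2 comp_id))) hn).
Qed.

Ltac comp_step :=
  match goal with
  | |- computable_nat (fun _ => ?k) => exact: (comp_const k)
  | |- computable_nat (fun x => x) => exact: comp_id
  | |- computable_nat (fun x => nat_of_bool (@?b x && @?c x)) =>
      apply: (@comp_ifb b c (fun=> false))
  | |- computable_nat (fun x => nat_of_bool (@?b x ==> @?c x)) =>
      apply: (@comp_ifb b c (fun=> true))
  | |- computable_nat (fun x => nat_of_bool (~~ @?b x)) => apply: (@comp_negb b)
  | |- computable_nat (fun x => nat_of_bool (@?f x <= @?g x)) => apply: (@comp_leq f g)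
  | |- computable_nat (fun x => nat_of_bool (@?f x == @?g x)) => apply: (@comp_eqn f g)
  | |- computable_nat (fun x => npair (@?f x) (@?g x)) => apply: (@comp_npair f g)
  | |- computable_nat (fun x => un1 (@?f x)) => apply: (@comp_un1 f)
  | |- computable_nat (fun x => un2 (@?f x)) => apply: (@comp_un2 f)
  | |- computable_nat (fun x => (@?f x).+1) => apply: (@comp_succ f)
  | |- computable_nat (fun x => (@?f x).-1) => apply: (@comp_pred f)
  | |- computable_nat (fun x => @?f x + @?g x) => apply: (@comp_add f g)
  | |- computable_nat (fun x => @?f x * @?g x) => apply: (@comp_mul f g)
  | |- computable_nat (fun x => @?f x - @?g x) => apply: (@comp_sub f g)
  | |- computable_nat (fun x => @?f x ^ @?g x) => apply: (@comp_exp f g)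
  | |- computable_nat (fun x => @?f x %/ (@?g x).+1) => apply: (@comp_divS f g)
  | |- computable_nat (fun x => iter (@?n x) ?F (@?a x)) => apply: (@comp_iter F n a)
  | H : computable_nat ?F |- computable_nat (fun x => ?F (@?g x)) =>
      first [exact: H | apply: (@comp_comp F g)]
  | H : computable_nat ?F |- _ => exact: H
  | _ => first [simple apply comp_ifb | simple apply comp_if]
  end; cbv beta.
Ltac comp := cbv beta; repeat comp_step.

(** * A small-step simulator of recursive programs *)

(** Machine states: [Ev] evaluates a program under the continuation [k], [Rt] returns a value to it.
    The dummy 0 in [Rt] aligns both layouts, so that [mstep] reads them with the same
    projections. *)
Definition Ev c x k := npair 0 (npair c (npair x k)).
Definition Rt y k := npair 1 (npair 0 (npair y k)).

(** Frames pushed here: 1 awaits the first half of a pair, 3 the inner value of a composition, 4 and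
    5 one turn of a recursion or a search, with its counter. Tags from 7 on all mean minimisation,
    so every number is a program. *)
Definition ev_step c x k :=
  let tag := un1 c in let f := un1 (un2 c) in let g := un2 (un2 c) in
  if tag == 0 then Rt 0 k else
  if tag == 1 then Rt x.+1 k else
  if tag == 2 then Rt (un1 x) k else
  if tag == 3 then Rt (un2 x) k else
  if tag == 4 then Ev f x (npair 1 (npair (npair g x) k)) else
  if tag == 5 then Ev g x (npair 3 (npair f k)) else
  if tag == 6 then Ev f (un1 x) (npair 4 (npair (npair g (npair x 0)) k)) else
  Ev f (npair x 0) (npair 5 (npair (npair f (npair x 0)) k)).

(* Continuations are nested frames [npair tag (npair data k)]; tag 0 halts. *)
Definition rt_step y k :=
  let tag := un1 k in let a := un1 (un1 (un2 k)) in let b := un2 (un1 (un2 k)) in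
  let k' := un2 (un2 k) in
  let x := un1 b in let i := un2 b in
  if tag == 0 then Rt y k else
  if tag == 1 then Ev a b (npair 2 (npair y k')) else
  if tag == 2 then Rt (npair (un1 (un2 k)) y) k' else
  if tag == 3 then Ev (un1 (un2 k)) y k' else
  if tag == 4 then
    if i < un2 x then Ev a (npair (un1 x) (npair i y))
                        (npair 4 (npair (npair a (npair x i.+1)) k'))
    else Rt y k'
  else
    if y == 0 then Rt i k'
    else Ev a (npair x i.+1) (npair 5 (npair (npair a (npair x i.+1)) k')).

Definition mstep s :=
  let c := un1 (un2 s) in let x := un1 (un2 (un2 s)) in let k := un2 (un2 (un2 s)) in
  if un1 s == 0 then ev_step c x k else rt_step x k.

Lemma comp_mstep : computable_nat mstep.
Proof. rewrite /mstep /ev_step /rt_step /Ev /Rt; cbv zeta. comp. Qed.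

Fixpoint gn (c : recfun) : nat :=
  match c with
  | RZero => npair 0 0
  | RSucc => npair 1 0
  | RLeft => npair 2 0
  | RRight => npair 3 0
  | RPair f g => npair 4 (npair (gn f) (gn g))
  | RComp f g => npair 5 (npair (gn f) (gn g))
  | RPrec f g => npair 6 (npair (gn f) (gn g))
  | RMu f => npair 7 (npair (gn f) 0)
  end.

Definition reaches s s' := exists t, iter t mstep s = s'.

Lemma reaches_trans s2 s1 s3 : reaches s1 s2 -> reaches s2 s3 -> reaches s1 s3.
Proof. by move=> [t <-] [t' <-]; exists (t' + t); rewrite iterD. Qed.

Lemma reaches_step s s' : reaches (mstep s) s' -> reaches s s'.
Proof. by move=> [t <-]; exists t.+1; rewrite iterSr. Qed.

Lemma reaches0 s : reaches s s.
Proof. by exists 0. Qed.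

Lemma mstep_Ev c x k : mstep (Ev c x k) = ev_step c x k.
Proof. by rewrite /mstep /Ev !unK. Qed.

Lemma mstep_Rt y k : mstep (Rt y k) = rt_step y k.
Proof. by rewrite /mstep /Rt !unK. Qed.

Ltac mrun := apply: reaches_step; rewrite ?mstep_Ev ?mstep_Rt /ev_step /rt_step /= ?unK /=.

Lemma reval_reaches c x y k : reval c x y -> reaches (Ev (gn c) x k) (Rt y k).
Proof.
elim: c x y k => [||||f IHf g IHg|f IHf g IHg|f IHf g IHg|f IHf] x y k.
- by move=> /= ->; mrun; exact: reaches0.
- by move=> /= ->; mrun; exact: reaches0.
- by move=> /= ->; mrun; exact: reaches0.
- by move=> /= ->; mrun; exact: reaches0.
- move=> [u [v [/IHf hf /IHg hg ->]]] /=; mrun; apply: (reaches_trans (hf _)).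
  by mrun; apply: (reaches_trans (hg _)); mrun; exact: reaches0.
- move=> [u /IHg hg /IHf hf] /=; mrun; apply: (reaches_trans (hg _)).
  by mrun; exact: hf.
- move=> /reval_prec [s [/IHf hf hg ->]] /=; mrun; apply: (reaches_trans (hf _)).
  (* Loop invariant, by induction on the number [j] of remaining turns; the search below is handled
     likewise. *)
  have H j i : i + j = un2 x ->
    reaches (Rt (s i) (npair 4 (npair (npair (gn g) (npair x i)) k))) (Rt (s (un2 x)) k).
    elim: j i => [|j IH] i eij.
      by mrun; rewrite -eij addn0 ltnn; exact: reaches0.
    mrun; rewrite ifT; last by rewrite -eij; lia.
    apply: reaches_trans (IHg _ _ _ (hg i _)) _; first by rewrite -eij; lia.
    by apply: IH; lia.
  exact: H.
- move=> [/IHf hy hm] /=; mrun.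
  have H j i : i + j = y ->
    reaches (Ev (gn f) (npair x i) (npair 5 (npair (npair (gn f) (npair x i)) k))) (Rt y k).
    elim: j i => [|j IH] i eij.
      rewrite (_ : i = y); last by lia.
      by apply: (reaches_trans (hy _)); mrun; exact: reaches0.
    have [|v /IHf hv] := hm i; first by lia.
    by apply: (reaches_trans (hv _)); mrun; apply: IH; lia.
  exact: H.
Qed.

(* The result of running program [i] on [x] for [t] steps: 0 if it has not halted,
   and [y.+1] if it has halted with value [y]. *)
Definition out i x t :=
  let s := iter t mstep (Ev i x 0) in
  if (un1 s == 1) && (un2 (un2 (un2 s)) == 0) then (un1 (un2 (un2 s))).+1 else 0.

Lemma comp_out f g h : computable_nat f -> computable_nat g -> computable_nat h ->
  computable_nat (fun x => out (f x) (g x) (h x)).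
Proof. by move=> hf hg hh; have hm := comp_mstep; rewrite /out /Ev; cbv zeta; comp. Qed.

(** A halted state is a fixed point of [mstep]: the empty continuation 0 carries the halting tag
    0. *)
Lemma out_mono i x y t t' : t <= t' -> out i x t = y.+1 -> out i x t' = y.+1.
Proof.
move=> /subnK <-; elim: (t' - t) => // j IH /IH; rewrite addSn {IH} /out.
set u := j + t; rewrite iterS; set s := iter u _ _.
case: ifP => // /andP[/eqP s1 /eqP s3] [sy].
by rewrite /mstep s1 /= s3 /rt_step un1_0 /= /Rt !unK /= sy.
Qed.

Lemma out_fun i x y y' t t' : out i x t = y.+1 -> out i x t' = y'.+1 -> y = y'.
Proof.
move=> h h'; have := out_mono (leq_maxl t t') h.
by rewrite (out_mono (leq_maxr t t') h') => -[].
Qed.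

Definition halts_to i x y := exists t, out i x t = y.+1.

Lemma reval_halts c x y : reval c x y -> halts_to (gn c) x y.
Proof.
move=> h; have [t ht] := reval_reaches 0 h; exists t.
by rewrite /out ht /Rt !unK.
Qed.

(** The simulator is itself computable: search for the halting time, then read the output. This
    covers every total number [i], whether or not it is of the form [gn c]. *)
Lemma halts_comp i F : (forall x, halts_to i x (F x)) -> computable_nat F.
Proof.
move=> iF.
have ex x : exists t, out i x t != 0 by have [t e] := iF x; exists t; rewrite e.
pose T x := ex_minn (ex x).
have cT : computable_nat T.
  apply: (@comp_search (fun x t => out i x t != 0)) => [|x|x m].
  - by have H := comp_out (comp_const i) (comp_un1 comp_id) (comp_un2 comp_id); comp.
  - by rewrite /T; case: ex_minnP.
  - by rewrite /T; case: ex_minnP => t _ mt mt'; apply/negP => /mt; rewrite leqNgt mt'.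
have := comp_pred (comp_out (comp_const i) comp_id cT).
rewrite (_ : (fun _ => _) = F) //; apply/funext => x.
rewrite /T; case: ex_minnP => t; case E: (out i x t) => [//|y] _ _ /=.
by have [t' h] := iF x; exact: out_fun E h.
Qed.

(** * Binary strings and the arithmetical predicate *)

Lemma str_code_rcons w b : str_code (rcons w b) = (str_code w).*2 + b.+1.
Proof. by rewrite /str_code -cats1 foldl_cat. Qed.

Lemma str_code_false w : (str_code w).*2.+1 = str_code (rcons w false).
Proof. by rewrite str_code_rcons addn1. Qed.

Lemma str_code_true w : (str_code w).*2.+2 = str_code (rcons w true).
Proof. by rewrite str_code_rcons addn2. Qed.

Lemma str_code_surj c : exists w, str_code w = c.
Proof.
elim/ltn_ind: c => -[|c] IH; first by exists [::].
have [|w hw] := IH (c./2); first by lia.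
by exists (rcons w (odd c)); rewrite str_code_rcons hw; have := odd_double_half c; lia.
Qed.

(** In binary, [(str_code w).+1] is a leading 1 followed by the bits of [w]; length is thus a
    logarithm and truncation a right shift. *)
Definition strlen c := trunc_log 2 c.+1.
Definition strtake c n := (c.+1 %/ 2 ^ (strlen c - n)).-1.

Lemma strlen_code w : strlen (str_code w) = size w.
Proof.
apply: trunc_log_eq => //; elim/last_ind: w => [//|w b /andP[h1 h2]].
by rewrite str_code_rcons size_rcons !expnS in h1 h2 *; case: b; lia.
Qed.

Lemma size_restr A n : size (restr A n) = n.
Proof. by rewrite size_mkseq. Qed.

Lemma restrS A n : restr A n.+1 = rcons (restr A n) (A n).
Proof. by rewrite /restr mkseqS. Qed.

Lemma strlen_restr A n : strlen (str_code (restr A n)) = n.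
Proof. by rewrite strlen_code size_restr. Qed.

Lemma strtake_restr A n k : n <= k ->
  strtake (str_code (restr A k)) n = str_code (restr A n).
Proof.
move=> nk; rewrite /strtake strlen_restr -[k in restr A k](subnK nk).
elim: (k - n) => [|j IH]; first by rewrite expn0 divn1.
rewrite addSn restrS str_code_rcons expnS divnMA -IH; congr (_ %/ _).-1.
by case: (A _); lia.
Qed.

Lemma comp_strlen f : computable_nat f -> computable_nat (fun x => strlen (f x)).
Proof.
move=> hf; apply: (@comp_search (fun x k => (f x).+1 < 2 ^ k.+1)); first by comp.
- by move=> x; apply: trunc_log_ltn.
- move=> x m; rewrite /strlen -leqNgt => lt; apply: leq_trans (trunc_logP (p := 2) _ _) => //.
  by rewrite leq_pexp2l.
Qed.

Lemma comp_strtake f g : computable_nat f -> computable_nat g ->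
  computable_nat (fun x => strtake (f x) (g x)).
Proof.
move=> hf hg; have hl := comp_strlen hf; rewrite /strtake.
rewrite (_ : (fun _ => _) =
  fun x => ((f x).+1 %/ ((2 ^ (strlen (f x) - g x)).-1).+1).-1); first by comp.
by apply/funext => x; rewrite prednK // expn_gt0.
Qed.

(* [a (npair s n)] approximates [2 ^ n] times the capital at [s] within 2, and
   the codes of the two children of [s] are [s.*2.+1] and [s.*2.+2]. *)
Definition ok (a h : nat -> nat) (z : nat) : bool :=
  let s := un1 z in let n := un1 (un2 z) in let m := un2 (un2 z) in
  let a0 := a (npair s.*2.+1 n) in let a1 := a (npair s.*2.+2 n) in
  [&& 2 ^ m * a (npair s n) <= 2 ^ n * (a (npair s m)).+2 + 2 ^ m.+1,
      (a (npair s n)).*2 <= a0 + a1 + 8,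
      a0 + a1 <= (a (npair s n)).*2 + 8 & h n <= h n.+1].

Definition halted i t z : bool :=
  let s := un1 z in let n := un1 (un2 z) in let m := un2 (un2 z) in
  [&& 0 < out i (npair s n) t, 0 < out i (npair s m) t,
      0 < out i (npair s.*2.+1 n) t, 0 < out i (npair s.*2.+2 n) t,
      0 < out i n t & 0 < out i n.+1 t].

(** The inequality d(w) <= r/(r+1) h(n) multiplied by [2 ^ m * r.+1], with slack for the error 2 of
    [a]. *)
Definition cap (a h : nat -> nat) (c n m r : nat) : bool :=
  a (npair c m) * r.+1 <= r * h n * 2 ^ m + 2 * r.+1.

(* A program [i] computing [x |-> npair (a x) (h x)] stands for the candidate
   martingale approximated by [a] and the candidate order [h]. The first component
   of [j] selects one of the reasons why a sequence may be outside the success set: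
   program [i] does not halt on [z]; [ok] fails at [z]; [h] is bounded by [z];
   [h] eventually dominates. The length of [c] bounds the number of steps, or
   encodes this bound together with the remaining universally quantified numbers. *)
Definition avoids i j c : bool :=
  let t := strlen c in
  let kind := un1 j in let z := un2 j in
  let a t x := un1 (out i x t).-1 in
  let h t x := un2 (out i x t).-1 in
  if kind == 0 then out i z t == 0 else
  if kind == 1 then halted i t z ==> ~~ ok (a t) (h t) z else
  if kind == 2 then (0 < out i (un1 t) (un2 t)) ==> (h (un2 t) (un1 t) <= z) else
  let n := un1 t in let m := un1 (un2 t) in let t' := un2 (un2 t) in
  let s := strtake c n in
  [&& un1 z <= n, 0 < out i (npair s m) t' & 0 < out i n t'] ==>
     cap (a t') (h t') s n m (un2 z).

Lemma comp_double f : computable_nat f -> computable_nat (fun x => (f x).*2).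
Proof.
by move=> hf; under [X in computable_nat X]funext => x do rewrite -muln2; comp.
Qed.

Ltac comp_str := cbv beta; repeat first [comp_step |
  match goal with
  | |- computable_nat (fun x => (@?f x).*2) => apply: (@comp_double f)
  | |- computable_nat (fun x => strlen (@?f x)) => apply: (@comp_strlen f)
  | |- computable_nat (fun x => strtake (@?f x) (@?g x)) => apply: (@comp_strtake f g)
  | |- computable_nat (fun x => out (@?f x) (@?g x) (@?h x)) => apply: (@comp_out f g h)
  end; cbv beta].

Lemma comp_avoids :
  computable_nat (fun z => avoids (un1 z) (un1 (un2 z)) (un2 (un2 z))).
Proof. rewrite /avoids /cap /ok /halted; cbv zeta. comp_str. Qed.

Lemma computable_avoids : computable_rel (fun i j w => avoids i j (str_code w)).
Proof.
have [c hc] := comp_avoids; exists c => i j w.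
by have := hc (npair i (npair j (str_code w))); rewrite !unK.
Qed.

Lemma total_out i F x t : (forall x, halts_to i x (F x)) -> 0 < out i x t ->
  (out i x t).-1 = F x.
Proof.
move=> iF; case E: (out i x t) => [//|y] _ /=; have [t' e] := iF x.
exact: out_fun E e.
Qed.

(** Each test is vacuous until the values it reads have been output, and is the true condition from
    then on. Totality rules out the alternative of not halting. *)
Lemma avoidsP i a h A : (forall x, halts_to i x (npair (a x) (h x))) ->
  (exists j, forall k, avoids i j (str_code (restr A k))) <->
  [\/ exists z, ~~ ok a h z, exists b, forall n, h n <= b |
      exists N r, forall n m, N <= n -> cap a h (str_code (restr A n)) n m r].
Proof.
move=> ia.
have ga x t : 0 < out i x t -> un1 (out i x t).-1 = a x.
  by move=> /(total_out ia) ->; rewrite unK.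
have gh x t : 0 < out i x t -> un2 (out i x t).-1 = h x.
  by move=> /(total_out ia) ->; rewrite unK.
have ok_halted t z : halted i t z ->
    ok (fun x => un1 (out i x t).-1) (fun x => un2 (out i x t).-1) z = ok a h z.
  by move=> /and5P[h1 h2 h3 h4 /andP[h5 h6]]; rewrite /ok !ga // !gh.
split.
- move=> [j]; rewrite /avoids; set z := un2 j.
  case E0: (un1 j == 0) => Hj.
    have [t ht] := ia z; have := Hj t; rewrite strlen_restr ht.
    by [].
  move: Hj; case E1: (un1 j == 1) => Hj.
    apply: Or31; exists z.
    pose s := un1 z; pose n := un1 (un2 z); pose m := un2 (un2 z).
    have [t1 e1] := ia (npair s n); have [t2 e2] := ia (npair s m).
    have [t3 e3] := ia (npair s.*2.+1 n); have [t4 e4] := ia (npair s.*2.+2 n).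
    have [t5 e5] := ia n; have [t6 e6] := ia n.+1.
    pose t := t1 + t2 + t3 + t4 + t5 + t6.
    have := Hj t; rewrite strlen_restr.
    have hz : halted i t z.
      rewrite /halted -/s -/n -/m (out_mono (t' := t) _ e1) ?(out_mono (t' := t) _ e2)
        ?(out_mono (t' := t) _ e3) ?(out_mono (t' := t) _ e4)
        ?(out_mono (t' := t) _ e5) ?(out_mono (t' := t) _ e6) //; rewrite /t; lia.
    by rewrite hz /= ok_halted.
  move: Hj; case E2: (un1 j == 2) => Hj.
    apply: Or32; exists z => n; have [t e] := ia n.
    by have := Hj (npair n t); rewrite strlen_restr !unK e /= unK.
  apply: Or33; exists (un1 z), (un2 z) => n m Nn.
  have [t1 e1] := ia (npair (str_code (restr A n)) m); have [t2 e2] := ia n.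
  (* The length of this prefix encodes the instance [n], [m] and a sufficient time; it is at least
     [n] since pairing dominates its components. *)
  have := Hj (npair n (npair m (maxn t1 t2))).
  rewrite strlen_restr !unK strtake_restr; last first.
    by apply: leq_trans (npair_ge _ _); rewrite leq_addr.
  rewrite Nn (out_mono (leq_maxl _ _) e1) (out_mono (leq_maxr _ _) e2) /=.
  by rewrite /cap (out_mono (leq_maxl _ _) e1) (out_mono (leq_maxr _ _) e2) /= !unK.
- case=> [[z hz]|[b hb]|[N [r H]]].
  + exists (npair 1 z) => k; rewrite /avoids !unK /=.
    by apply/implyP => hh; rewrite ok_halted.
  + exists (npair 2 b) => k; rewrite /avoids !unK /= strlen_restr.
    by apply/implyP => hh; rewrite gh.
  + exists (npair 3 (npair N r)) => k; rewrite /avoids !unK /= strlen_restr.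
    apply/implyP => /and3P[Nn]; set n := un1 k in Nn *.
    have nk : n <= k by rewrite -[k in _ <= k]npairK (leq_trans _ (npair_ge _ _)) // leq_addr.
    by rewrite strtake_restr // => h1 h2; rewrite /cap ga // gh //; exact: H.
Qed.

Lemma not_total_avoids i A : (exists x, forall y, ~ halts_to i x y) ->
  exists j, forall k, avoids i j (str_code (restr A k)).
Proof.
move=> [x hx]; exists (npair 0 x) => k; rewrite /avoids !unK /=.
by case E: (out i x _) => [//|y]; case: (hx y); exists (strlen (str_code (restr A k))).
Qed.

(** * Martingales and their integer approximations *)

Import Order.TTheory GRing.Theory Num.Theory.
Import numFieldNormedType.Exports.

Local Open Scope classical_set_scope.
Local Open Scope ring_scope.

Lemma str_code_inj : injective str_code.
Proof.
elim/last_ind => [|w b IH] v; case/lastP: v => [|v c] //; rewrite ?str_code_rcons.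
- by rewrite (erefl : str_code [::] = 0%N) => e; exfalso; lia.
- by rewrite (erefl : str_code [::] = 0%N) => e; exfalso; lia.
- by move=> e; have [/IH -> ->] : str_code w = str_code v /\ b = c by lia.
Qed.

Definition unstr (c : nat) : seq bool := sval (cid (str_code_surj c)).

Lemma unstrK c : str_code (unstr c) = c.
Proof. by rewrite /unstr; case: cid. Qed.

Lemma str_codeK w : unstr (str_code w) = w.
Proof. by apply: str_code_inj; rewrite unstrK. Qed.

Lemma computable_str_natE f : computable_str_nat f <->
  computable_nat (fun x => f (unstr (un1 x)) (un2 x)).
Proof.
split=> -[c hc]; exists c.
  by move=> x; have := hc (unstr (un1 x)) (un2 x); rewrite unstrK npairK.
by move=> w n; have := hc (npair (str_code w) n); rewrite !unK str_codeK.
Qed.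

Section Approximations.
Context {R : realType}.
Implicit Types (d : seq bool -> R) (a h : nat -> nat).

Lemma natdiv_bounds (x y : nat) :
  (x %/ y.+1)%:R <= x%:R / y.+1%:R :> R /\ x%:R / y.+1%:R <= (x %/ y.+1)%:R + 1 :> R.
Proof.
split; first by rewrite ler_pdivlMr ?ltr0n // -natrM ler_nat leq_trunc_div.
by rewrite ler_pdivrMr ?ltr0n // natr1 -natrM ler_nat ltnW // ltn_ceil.
Qed.

Lemma ltr_pow2 n : n%:R < 2 ^+ n :> R.
Proof. by rewrite -natrX ltr_nat ltn_expl. Qed.

Lemma pow2_gt0 n : 0 < 2 ^+ n :> R.
Proof. by rewrite exprn_gt0. Qed.

(** Makes exact an inequality known at every scale [2 ^+ m] up to a fixed error. *)
Lemma le_pow2_limit (x y c : R) : (forall m, 2 ^+ m * x <= 2 ^+ m * y + c) -> x <= y.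
Proof.
move=> H; rewrite leNgt; apply/negP => xy.
have e0 : 0 < x - y by rewrite subr_gt0.
set m := Num.bound (`|c| / (x - y)).
have h1 : `|c| / (x - y) < m%:R by apply: archi_boundP; rewrite divr_ge0 // ltW.
rewrite ltr_pdivrMr // in h1.
have h2 : m%:R * (x - y) <= 2 ^+ m * (x - y) by rewrite ler_pM2r // ltW // ltr_pow2.
have := H m; have := ler_norm c; lra.
Qed.

Definition approx d a :=
  forall w n, `|2 ^+ n * d w - (a (npair (str_code w) n))%:R| <= 2.

Lemma approxP d a w n : approx d a ->
  (a (npair (str_code w) n))%:R <= 2 ^+ n * d w + 2 /\
  2 ^+ n * d w <= (a (npair (str_code w) n))%:R + 2.
Proof. by move=> /(_ w n); rewrite ler_norml => /andP[h1 h2]; split; lra. Qed.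

(** The error 2 is 1 from the rational approximation plus 1 from rounding down. Conversely, an error
    2 at scale [n.+1] is exactly [2 ^- n]. *)
Lemma computable_real_approx d :
  computable_real_fun d <-> exists2 a, computable_nat a & approx d a.
Proof.
split.
- move=> [p [q [/computable_str_natE hp /computable_str_natE hq H]]].
  exists (fun x => 2 ^ un2 x * p (unstr (un1 x)) (un2 x) %/ (q (unstr (un1 x)) (un2 x)).+1)%N.
    by apply: comp_divS => //; apply: comp_mul => //; comp.
  move=> w n; rewrite !unK str_codeK.
  have [h1 h2] := natdiv_bounds (2 ^ n * p w n) (q w n).
  have := H w n; rewrite natrM natrX in h1 h2; rewrite ler_norml => /andP[].
  have e2 : 2 ^+ n * 2 ^- n = 1 :> R by rewrite divff // gt_eqF // pow2_gt0.
  move=> /(ler_wpM2l (ltW (pow2_gt0 n))) h3 /(ler_wpM2l (ltW (pow2_gt0 n))) h4.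
  rewrite mulrBr mulrA ?mulrN e2 in h3 h4.
  move: h1 h2 h3 h4; move: (_ %/ _)%N%:R (_ / _) (2 ^+ n * d w) => u v x h1 h2 h3 h4.
  by rewrite ler_norml; apply/andP; split; lra.
- move=> [a ha H].
  exists (fun w n => a (npair (str_code w) n.+1)), (fun _ n => (2 ^ n.+1).-1)%N; split.
  + apply/computable_str_natE.
    by under [X in computable_nat X]funext => x do rewrite unstrK; comp.
  + by apply/computable_str_natE; comp.
  + move=> w n; rewrite prednK ?expn_gt0 // natrX.
    have P := pow2_gt0 n.+1.
    have -> : 2 ^- n = 2 / 2 ^+ n.+1 :> R.
      by rewrite exprS invfM mulrA divff ?mul1r // gt_eqF.
    have -> : d w - (a (npair (str_code w) n.+1))%:R / 2 ^+ n.+1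
            = (2 ^+ n.+1 * d w - (a (npair (str_code w) n.+1))%:R) / 2 ^+ n.+1.
      by rewrite mulrBl mulrAC divff ?mul1r // gt_eqF.
    by rewrite normrM normfV (gtr0_norm P) ler_pM2r ?invr_gt0.
Qed.

(** The slack 8 is 4 from doubling the error at the parent and 2 from each child. *)
Lemma martingale_ok d a h z : martingale d -> approx d a ->
  {homo h : m n / (m <= n)%N} -> ok a h z.
Proof.
move=> [_ dm] da hh; rewrite /ok; have [w <-] := str_code_surj (un1 z).
move: (un1 (un2 z)) (un2 (un2 z)) => n m.
rewrite str_code_true str_code_false hh // andbT.
have [h1 h2] := approxP w n da; have [h3 h4] := approxP w m da.
have [h5 h6] := approxP (rcons w false) n da; have [h7 h8] := approxP (rcons w true) n da.
have e : 2 ^+ n * (2 * d w) = 2 ^+ n * d (rcons w false) + 2 ^+ n * d (rcons w true).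
  by rewrite dm mulrDr.
apply/and3P; split; rewrite -(ler_nat R).
- rewrite natrD !natrM !natrX -[(a _).+2]addn2 natrD exprS.
  have h9 := ler_wpM2l (ltW (pow2_gt0 n)) h4; have h10 := ler_wpM2l (ltW (pow2_gt0 m)) h1.
  move: h9 h10 => {e h1 h2 h3 h4 h5 h6 h7 h8}.
  move: (a _)%:R (a _)%:R (2 ^+ n) (2 ^+ m) (d w) => x y p q u; lra.
- by rewrite -muln2 !natrD natrM; lra.
- by rewrite -muln2 !natrD natrM; lra.
Qed.

(** The first clause of [ok] puts every lower estimate (a-2)/2^n below every upper estimate
    (a+2)/2^m, so the infimum of the upper estimates lies within the error at all scales. *)
Lemma ok_martingale a h : (forall z, ok a h z) ->
  exists2 d, martingale d & approx d a.
Proof.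
move=> H; pose al w n : R := (a (npair (str_code w) n))%:R.
pose E w := range (fun n => (al w n + 2) / 2 ^+ n).
have lbE w n : lbound (E w) ((al w n - 2) / 2 ^+ n).
  move=> _ [m _ <-]; have P := pow2_gt0 n; have Q := pow2_gt0 m.
  rewrite ler_pdivrMr // mulrAC ler_pdivlMr //.
  have := H (npair (str_code w) (npair n m)); rewrite /ok !unK => /and4P[+ _ _ _].
  rewrite -(ler_nat R) natrD !natrM !natrX -[(a _).+2]addn2 natrD exprS -/(al w n) -/(al w m); lra.
have hE w : has_lbound (E w) by exists ((al w 0%N - 2) / 2 ^+ 0); exact: lbE.
have nE w : E w !=set0 by exists ((al w 0%N + 2) / 2 ^+ 0); exists 0%N.
pose d w := inf (E w).
have da : approx d a.
  move=> w n; have P := pow2_gt0 n.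
  have h1 : (al w n - 2) / 2 ^+ n <= d w by apply: lb_le_inf; [exact: nE|exact: lbE].
  have h2 : d w <= (al w n + 2) / 2 ^+ n by apply: ge_inf => //; exists n.
  rewrite ler_pdivrMr // in h1; rewrite ler_pdivlMr // in h2.
  by rewrite ler_norml -/(al w n); apply/andP; split; lra.
exists d => //; split=> w.
  by apply: lb_le_inf => // _ [n _ <-]; rewrite divr_ge0 ?addr_ge0 // ltW // pow2_gt0.
have K n : 2 * al w n <= al (rcons w false) n + al (rcons w true) n + 8 /\
           al (rcons w false) n + al (rcons w true) n <= 2 * al w n + 8.
  have := H (npair (str_code w) (npair n 0)).
  rewrite /ok !unK str_code_true str_code_false => /and4P[_ + + _].
  by rewrite -!(ler_nat R) -muln2 !natrD natrM /al; split; lra.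
(* 16 is the slack 8 of [ok] plus 4 for the doubled parent and 2 for each child. *)
by apply/eqP; rewrite eq_le; apply/andP; split; apply: (@le_pow2_limit _ _ 16) => n;
  have [k1 k2] := K n; have [h1 h2] := approxP w n da;
  have [h3 h4] := approxP (rcons w false) n da; have [h5 h6] := approxP (rcons w true) n da;
  rewrite -?/(al _ _) in h1 h2 h3 h4 h5 h6; lra.
Qed.

Lemma cap_le d a h w n r : martingale d -> approx d a ->
  (forall m, cap a h (str_code w) n m r) -> d w / (h n)%:R <= r%:R / r.+1%:R.
Proof.
(* Division by [h n = 0] yields 0, which meets the bound. *)
move=> [d0 _] da H; have [->|hn] := posnP (h n).
  by rewrite invr0 mulr0 divr_ge0.
rewrite ler_pdivrMr ?ltr0n // mulrAC ler_pdivlMr ?ltr0n //.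
apply: (@le_pow2_limit _ _ (4 * r.+1%:R)) => m.
have := H m; rewrite /cap -(ler_nat R) natrD !natrM natrX.
have [_ h2] := approxP w m da.
have : 2 ^+ m * d w * r.+1%:R <= ((a (npair (str_code w) m))%:R + 2) * r.+1%:R.
  by rewrite ler_pM2r ?ltr0n.
lra.
Qed.

Lemma le_cap d a h w n m r : approx d a -> (0 < h n)%N ->
  d w / (h n)%:R <= r%:R / r.+1%:R -> cap a h (str_code w) n m r.
Proof.
move=> da hn; rewrite ler_pdivrMr ?ltr0n // mulrAC ler_pdivlMr ?ltr0n //.
move=> /(ler_wpM2l (ltW (pow2_gt0 m))) H.
rewrite /cap -(ler_nat R) natrD !natrM natrX.
have [h1 _] := approxP w m da.
have : (a (npair (str_code w) m))%:R * r.+1%:R <= (2 ^+ m * d w + 2) * r.+1%:R.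
  by rewrite ler_pM2r ?ltr0n.
lra.
Qed.

Lemma lt1_ratio (x : R) : x < 1 -> exists r : nat, x <= r%:R / r.+1%:R.
Proof.
move=> x1; have e0 : 0 < 1 - x by rewrite subr_gt0.
set m := Num.bound ((1 - x)^-1); exists m.
have : (1 - x)^-1 < m%:R by apply: archi_boundP; rewrite invr_ge0 ltW.
rewrite -[X in X < _]mul1r ltr_pdivrMr // => h.
by rewrite ler_pdivlMr ?ltr0n // -natr1; lra.
Qed.

(** The ratios r/(r+1) are cofinal below 1, so a limit superior below 1 is eventually witnessed by
    one of them. *)
Lemma not_success_setP h d A : ~ success_set h d A <->
  exists N r, forall n, (N <= n)%N -> d (restr A n) / (h n)%:R <= r%:R / r.+1%:R.
Proof.
rewrite /success_set /= /limn_esup /limf_esup; split.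
- move=> /negP; rewrite -ltNge => /ereal_inf_lt[_ [V [N _ NV] <-] hV].
  set s := ereal_sup _ in hV.
  have sup_le n : (N <= n)%N -> ((d (restr A n) / (h n)%:R)%:E <= s)%E.
    by move=> Nn; apply: ereal_sup_ubound; exists n => //; exact: NV.
  have [r hr] : exists r : nat, (s <= (r%:R / r.+1%:R)%:E)%E.
    case: s hV {sup_le} => [s|//|_]; last by exists 0%N; rewrite leNye.
    by rewrite lte_fin => /lt1_ratio[r hr]; exists r; rewrite lee_fin.
  exists N, r => n /sup_le /le_trans /(_ hr); by rewrite lee_fin.
- move=> [N [r H]]; apply/negP; rewrite -ltNge.
  apply: (@le_lt_trans _ _ (r%:R / r.+1%:R)%:E).
    apply: (@le_trans _ _
      (ereal_sup [set (d (restr A n) / (h n)%:R)%:E | n in [set n | (N <= n)%N]])).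
      by apply: ereal_inf_lbound; exists [set n | (N <= n)%N] => //; exists N.
    by apply: ge_ereal_sup => _ [n /= Nn <-]; rewrite lee_fin H.
  by rewrite lte_fin ltr_pdivrMr ?ltr0n // mul1r ltr_nat.
Qed.

End Approximations.

(** * The upper bound *)

Lemma lightface_Pi03_schnorr_random (R : realType) : lightface_Pi03 (schnorr_random R).
Proof.
exists (fun i j w => avoids i j (str_code w)); first exact: computable_avoids.
apply/seteqP; split=> A /= H.
- move=> i; have [tot|ntot] := pselect (forall x, exists y, halts_to i x y); last first.
    apply: not_total_avoids; have [x /forallNP hx] := (existsNP _).2 ntot.
    by exists x.
  have [F iF] := choice tot.
  have iF' x : halts_to i x (npair (un1 (F x)) (un2 (F x))) by rewrite npairK.
  have cF := halts_comp iF.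
  apply/(avoidsP (a := fun x => un1 (F x)) (h := fun x => un2 (F x)) A iF').
  set a := fun x => un1 (F x); set h := fun x => un2 (F x).
  have [okz|/existsNP[z /negP nz]] := pselect (forall z, ok a h z); last by apply: Or31; exists z.
  have [[b hb]|hu] := pselect (exists b, forall n, (h n <= b)%N); first by apply: Or32; exists b.
  have [d dm da] := ok_martingale (R := R) okz.
  have hmono : {homo h : m n / (m <= n)%N}.
    apply: homo_leq => // [y x z|n]; first exact: leq_trans.
    by have := okz (npair 0 (npair n 0)); rewrite /ok !unK => /and4P[].
  have hub b : exists n, (b < h n)%N.
    apply/not_existsP => hn; apply: hu; exists b => n; rewrite leqNgt; exact/negP/hn.
  have /not_success_setP[N [r K]] : ~ success_set h d A.
    apply: H => //; last by rewrite /h; comp.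
    by apply/computable_real_approx; exists a => //; rewrite /a; comp.
  have [M hM] := hub 0%N.
  (* Beyond [M] the order is positive, as [le_cap] requires. *)
  apply: Or33; exists (maxn N M), r => n m; rewrite geq_max => /andP[Nn Mn].
  by apply: (le_cap m da) (K n Nn); apply: leq_trans hM (hmono _ _ Mn).
- move=> d h dm /computable_real_approx[a [ca hca] da] [hh hub] [ch hch].
  apply/not_success_setP.
  have iF x : halts_to (gn (RPair ca ch)) x (npair (a x) (h x)).
    by apply: reval_halts; exists (a x), (h x).
  have := H (gn (RPair ca ch)) => /(avoidsP A iF)[[z]|[b hb]|[N [r K]]].
  + by rewrite (martingale_ok z dm da hh).
  + by have [n] := hub b; rewrite ltnNge hb.
  + by exists N, r => n Nn; apply: (cap_le dm da) => m; exact: K.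
Qed.

(** * Cylinders and limits of chains of prefixes *)

Lemma restr_eqP (A B : cantor_space) n :
  restr A n = restr B n <-> forall i, (i < n)%N -> A i = B i.
Proof.
split=> [e i lin|e]; first by rewrite -(nth_mkseq false A lin) -/(restr A n) e nth_mkseq.
by apply/eq_in_map => i; rewrite mem_iota => /andP[_]; exact: e.
Qed.

Lemma restr_eq_le (A B : cantor_space) m n : (m <= n)%N ->
  restr A n = restr B n -> restr A m = restr B m.
Proof.
move=> mn /restr_eqP e; apply/restr_eqP => i im; apply: e; exact: leq_trans im mn.
Qed.

Lemma open_restr (U : set cantor_space) A : open U -> U A ->
  exists n, forall B, restr B n = restr A n -> U B.
Proof.
move=> oU UA; apply/not_existsP => H.
have {}H n : exists B : cantor_space, restr B n = restr A n /\ ~ U B.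
  by have /existsNP[B /not_implyP] := H n; exists B.
have [B HB] := choice H.
have cvB : B n @[n --> \oo] --> A.
  apply/cvg_sup => i V [_ [[W oW <-] /= WA WV]].
  exists i.+1 => // m /= im; apply: WV; rewrite /=.
  by have [/restr_eqP e _] := HB m; rewrite /proj e.
have : nbhs A U by apply: open_nbhs_nbhs; split.
move=> /cvB [N _ HN]; have [_] := HB N; apply; exact: HN (leqnn N).
Qed.

(** Dependent choice for finite-extension arguments: [I] is the invariant of a state, [P k] the task
    of stage [k], and the first [len s] bits are frozen. *)
Lemma chain_limit (S : Type) (pt : S -> cantor_space) (len : S -> nat)
    (I : S -> Prop) (P : nat -> S -> S -> Prop) s0 : I s0 ->
  (forall k s, I s -> exists s', [/\ I s',
     restr (pt s') (len s) = restr (pt s) (len s), (len s < len s')%N & P k s s']) ->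
  exists (s : nat -> S) (L : cantor_space), [/\ forall k, I (s k),
    forall k, P k (s k) (s k.+1), forall k, (k <= len (s k))%N,
    forall k, (len (s k) < len (s k.+1))%N &
    forall k, restr L (len (s k)) = restr (pt (s k)) (len (s k))].
Proof.
move=> I0 step.
have /choice[f Hf] : forall ks : nat * S, exists s', I ks.2 -> [/\ I s',
     restr (pt s') (len ks.2) = restr (pt ks.2) (len ks.2), (len ks.2 < len s')%N & P ks.1 ks.2 s'].
  move=> [k s] /=; have [/(step k)[s' hs']|nI] := pselect (I s); first by exists s'.
  by exists s => /nI.
pose s := fix s k := if k is k'.+1 then f (k', s k') else s0.
have Is k : I (s k) by elim: k => // k /(Hf (k, _)) [].
have Hs k := Hf (k, s k) (Is k).
have ltlen k : (len (s k) < len (s k.+1))%N by have [] := Hs k.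
have gelen k : (k <= len (s k))%N by elim: k => // k IH; apply: leq_ltn_trans IH (ltlen k).
have lelen j k : (len (s k) <= len (s (j + k)%N))%N.
  by elim: j => // j IH; apply: leq_trans IH (ltnW (ltlen _)).
have coh j k : restr (pt (s (j + k)%N)) (len (s k)) = restr (pt (s k)) (len (s k)).
  elim: j => // j <-; apply: (restr_eq_le (lelen j k)).
  by have [] := Hs (j + k)%N.
(* Stage [i.+1] has frozen at least [i.+1] bits, bit [i] among them. *)
exists s, (fun i => pt (s i.+1) i); split => // [k|k]; first by have [] := Hs k.
apply/restr_eqP => i ilt; have [ki|ik] := leqP k i.+1.
  by have /restr_eqP := coh (i.+1 - k)%N k; rewrite subnK // => ->.
have /restr_eqP := coh (k - i.+1)%N i.+1; rewrite subnK; last exact: ltnW.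
by move=> ->.
Qed.

Lemma exists_follow (g : seq bool -> bool) (A : cantor_space) n :
  exists2 B, restr B n = restr A n & forall i, (n <= i)%N -> B i = g (restr B i).
Proof.
pose s := fix s j := if j is j'.+1 then rcons (s j') (g (s j')) else restr A n.
have szs j : size (s j) = (j + n)%N by elim: j => [|j IH] /=; rewrite ?size_restr ?size_rcons ?IH.
have pre j k i : (i < k + n)%N -> nth false (s (j + k)%N) i = nth false (s k) i.
  move=> lt; elim: j => // j <-; rewrite /= nth_rcons szs ifT //; lia.
pose B : cantor_space := fun i => nth false (s i.+1) i.
have rB j : restr B (j + n)%N = s j.
  apply: (@eq_from_nth _ false) => [|i]; rewrite size_restr ?szs // => lt.
  rewrite nth_mkseq // /B; have [h|h] := leqP i.+1 j.
    by rewrite -[in RHS](subnK h) pre //; lia.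
  by rewrite -(subnK (ltnW h)) pre.
exists B => [|i ni]; first exact: (rB 0%N).
rewrite -[i in restr B i](subnK ni) rB /B.
have -> : (i.+1 = n + (i - n).+1)%N by lia.
rewrite pre; last by lia.
by rewrite /= nth_rcons szs subnK // ltnn eqxx.
Qed.

(** * Betting on a predicted bit *)

(* The capital (up to a power of 2) of a gambler who at each step wagers half
   of it on the next bit being the one predicted by [g]. *)
Definition stake_upto (g : nat -> bool) (c k : nat) : nat :=
  nat_rect (fun=> nat) 1%N (fun i s => s *
    if strtake c i.+1 == ((strtake c i).*2.+1 + g (strtake c i))%N then 3 else 1)%N k.

Definition stake g c := stake_upto g c (strlen c).

Lemma comp_stake (g : nat -> bool) f : computable_nat (fun c => g c) ->
  computable_nat f -> computable_nat (fun x => stake g (f x)).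
Proof.
move=> hg hf; rewrite /stake /stake_upto.
apply: (@comp_natrec (fun=> 1%N) (fun x i s => s * if strtake (f x) i.+1 ==
  ((strtake (f x) i).*2.+1 + g (strtake (f x) i))%N then 3 else 1)%N (fun x => strlen (f x))).
- by comp.
- apply: comp_mul; first by comp_str.
  apply: comp_if; last 2 first; [by comp|by comp|].
  apply: comp_eqn; first by comp_str.
  apply: comp_add; first by comp_str.
  apply: (@comp_comp (fun c => g c)) => //; by comp_str.
- by comp_str.
Qed.

Lemma stake_upto_restr g (A : cantor_space) k n : (k <= n)%N ->
  stake_upto g (str_code (restr A n)) k = stake g (str_code (restr A k)).
Proof.
move=> kn; rewrite /stake strlen_restr.
have H j : (j <= k)%N ->
    stake_upto g (str_code (restr A n)) j = stake_upto g (str_code (restr A k)) j.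
  elim: j => // j IH jk /=; rewrite IH ?(ltnW jk) // !strtake_restr //; lia.
exact: H.
Qed.

Lemma stake_restrS g (A : cantor_space) n : stake g (str_code (restr A n.+1)) =
  (stake g (str_code (restr A n)) * if A n == g (str_code (restr A n)) then 3 else 1)%N.
Proof.
rewrite {1}/stake strlen_restr -(stake_upto_restr g A (leqnSn n)) /= !strtake_restr //.
congr (_ * _)%N; rewrite restrS str_code_rcons.
by congr (if _ then _ else _); case: (A n) (g _) => -[]; rewrite /=; lia.
Qed.

Lemma rcons_restr w b : exists A : cantor_space, restr A (size w) = w /\ A (size w) = b.
Proof.
exists (nth false (rcons w b)); rewrite nth_rcons ltnn eqxx; split=> //.
apply: (@eq_from_nth _ false); rewrite size_restr // => i lt.
by rewrite nth_mkseq // nth_rcons lt.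
Qed.

Lemma stake_rcons g w b : stake g (str_code (rcons w b)) =
  (stake g (str_code w) * if b == g (str_code w) then 3 else 1)%N.
Proof.
have [A [eA <-]] := rcons_restr w b.
by rewrite -{1 3 4}eA -restrS stake_restrS eA.
Qed.

Lemma stake_gt0 g w : (0 < stake g (str_code w))%N.
Proof.
elim/last_ind: w => // w b IH; rewrite stake_rcons muln_gt0 IH /=.
by case: ifP.
Qed.

Section NotSigma03.
Context {R : realType}.
Implicit Types (d D : seq bool -> R) (A B C : cantor_space).

Definition bet (g : nat -> bool) (w : seq bool) : R :=
  (stake g (str_code w))%:R / 2 ^+ size w.

Lemma martingale_bet g : martingale (bet g).
Proof.
split=> w; rewrite /bet; first by rewrite divr_ge0 // exprn_ge0.
rewrite !stake_rcons !size_rcons !natrM exprS.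
have P := pow2_gt0 (R := R) (size w).
by case: (g _) => /=; field; rewrite gt_eqF.
Qed.

Lemma computable_bet (g : nat -> bool) :
  computable_nat (fun c => g c) -> computable_real_fun (bet g).
Proof.
move=> hg; exists (fun w _ => stake g (str_code w)), (fun w _ => (2 ^ size w).-1)%N; split.
- apply/computable_str_natE; under [X in computable_nat X]funext => x do rewrite unstrK.
  exact: comp_stake hg (comp_un1 comp_id).
- apply/computable_str_natE.
  under [X in computable_nat X]funext => x do rewrite -strlen_code unstrK.
  by comp_str.
- move=> w n; rewrite prednK ?expn_gt0 // natrX subrr normr0 invr_ge0 exprn_ge0 //.
Qed.

Lemma stake_follow g A n j :
  (forall i, (n <= i)%N -> A i = g (str_code (restr A i))) ->
  (3 ^ j <= stake g (str_code (restr A (j + n)%N)))%N.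
Proof.
move=> H; elim: j => [|j IH]; first by rewrite expn0 stake_gt0.
by rewrite addSn stake_restrS -H ?leq_addl // eqxx expnSr leq_mul.
Qed.

Lemma bet_follow g A n :
  (forall i, (n <= i)%N -> A i = g (str_code (restr A i))) ->
  let m := (4 * n + 8 + n)%N in 1 <= bet g (restr A m) / m%:R.
Proof.
move=> /(stake_follow (4 * n + 8)); set m := (4 * n + 8 + n)%N => H; cbv zeta.
have m0 : (0 < m)%N by rewrite /m; lia.
rewrite ler_pdivlMr ?ltr0n // mul1r /bet ler_pdivlMr ?pow2_gt0 // size_restr.
rewrite -natrX -natrM ler_nat; apply: leq_trans H.
(* With m = 5n+8 one has m <= 2^(n+4), so m 2^m <= 2^(6n+12) = 8^(2n+4) <= 9^(2n+4) = 3^(4n+8). *)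
rewrite (_ : 4 * n + 8 = 2 * (2 * n + 4))%N; last by lia.
apply: (@leq_trans (2 ^ (n + 4 + m))).
  rewrite expnD leq_mul2r; apply/orP; right.
  have := ltn_expl n (isT : (1 < 2)%N); rewrite expnD /m; lia.
rewrite (_ : n + 4 + m = 3 * (2 * n + 4))%N; last by rewrite /m; lia.
by rewrite !expnM leq_exp2r //; lia.
Qed.

(** * Greedy paths and forcing a sequence out of a G_delta set *)

Definition potential D w : R := D w + 2 ^- size w.

(** At precision |w|+3, the chosen child exceeds D(w) by at most 2^-(|w|+2), less than the drop
    2^-(|w|+1) of the extra term of [potential]. *)
Definition greedy (a : nat -> nat) (c : nat) : bool :=
  let n := (strlen c + 3)%N in (a (npair c.*2.+2 n) <= a (npair c.*2.+1 n))%N.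

Lemma comp_greedy a : computable_nat a -> computable_nat (fun c => greedy a c).
Proof. by move=> ha; rewrite /greedy; cbv zeta; comp_str. Qed.

(* The term [2 ^- size w] of the potential pays for comparing approximations
   instead of the true values of [D] at the two children of [w]. *)
Lemma greedy_potential D a w : martingale D -> approx D a ->
  potential D (rcons w (greedy a (str_code w))) <= potential D w.
Proof.
move=> [_ dm] da; rewrite /potential size_rcons /greedy strlen_code.
set n := (size w + 3)%N; rewrite str_code_true str_code_false.
have [h1 h2] := approxP (rcons w false) n da.
have [h3 h4] := approxP (rcons w true) n da.
have P := pow2_gt0 (R := R) (size w).
have e := congr1 (fun x => 2 ^+ n * x) (dm w); rewrite /= in e.
have q1 : 2 ^+ n * 2 ^- size w = 8 :> R.
  by rewrite /n exprD mulrAC divff ?gt_eqF // mul1r -natrX.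
have q2 : 2 ^- size w = 2 * 2 ^- (size w).+1 :> R.
  by rewrite exprS invfM mulrA divff ?mul1r.
rewrite mulrDr q2 in e q1.
rewrite -(ler_pM2l (pow2_gt0 n)) !mulrDr q2.
by case: leqP; rewrite -?(ler_nat R) -?(ltr_nat R) => h; lra.
Qed.

Lemma exists_greedy_path D a A n : martingale D -> approx D a ->
  potential D (restr A n) < 1 ->
  exists B m, [/\ (n < m)%N, restr B n = restr A n,
    forall k, (n <= k)%N -> potential D (restr B k) < 1 &
    1 <= bet (greedy a) (restr B m) / m%:R].
Proof.
move=> dm da pA.
have [B eB gB] := exists_follow (fun w => greedy a (str_code w)) A n.
exists B, (4 * n + 8 + n)%N; split => //; [lia| |exact: bet_follow].
move=> k /subnK <-; elim: (k - n)%N => [|j IH]; first by rewrite eB.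
rewrite addSn restrS gB ?leq_addl //; apply: le_lt_trans IH.
exact: greedy_potential.
Qed.

Lemma order_id : order_fun id.
Proof. by split=> // b; exists b.+1. Qed.

Lemma Gdelta_avoid (G : set cantor_space) D A n : Gdelta G ->
  G `<=` schnorr_random R -> martingale D -> computable_real_fun D ->
  potential D (restr A n) < 1 ->
  exists B m, [/\ (n < m)%N, restr B n = restr A n,
    forall k, (n <= k <= m)%N -> potential D (restr B k) < 1 &
    forall C, restr C m = restr B m ->
      (forall k, (m <= k)%N -> potential D (restr C k) < 1) -> ~ G C].
Proof.
move=> [F oF ->] GR dm /computable_real_approx[a ca da] pA; apply/not_existsP => H.
pose I (s : cantor_space * nat) := [/\ (n < s.2)%N, restr s.1 n = restr A n &
  forall k, (n <= k <= s.2)%N -> potential D (restr s.1 k) < 1].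
pose P k (s s' : cantor_space * nat) :=
  (forall C, restr C s'.2 = restr s'.1 s'.2 -> F k C) /\
  1 <= bet (greedy a) (restr s'.1 s'.2) / s'.2%:R.
have [B0 [m0 [nm0 eB0 pB0 _]]] := exists_greedy_path dm da pA.
have I0 : I (B0, m0) by split=> // k /andP[nk _]; exact: pB0.
have [|s [L [Is Ps les lts Ls]]] := @chain_limit _ fst snd I P _ I0.
  move=> k [B m] [/= nm eB pB].
  (* If no such point existed, [B] and [m] would satisfy the conclusion that is assumed to fail. *)
  have [C [eC pC GC]] : exists C, [/\ restr C m = restr B m,
      forall k, (m <= k)%N -> potential D (restr C k) < 1 & (\bigcap_i F i) C].
    apply: contrapT => nC; apply: (H B); exists m; split=> // C eC pC GC; apply: nC.
    by exists C.
  (* Enter the open set [F k] along [C], then follow the greedy bits until the bet reaches the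
     length of the prefix. *)
  have [l hl] := open_restr (oF k) (GC k Logic.I).
  have pCl : potential D (restr C (maxn l m.+1)) < 1 by apply: pC; lia.
  have [E [q [lq eE pE bE]]] := exists_greedy_path dm da pCl.
  have pE' j : (n <= j <= q)%N -> potential D (restr E j) < 1.
    move=> /andP[nj jq]; have [h|h] := leqP (maxn l m.+1) j; first exact: pE.
    rewrite (restr_eq_le (ltnW h) eE); have [h'|h'] := leqP m j; first exact: pC.
    by rewrite (restr_eq_le (ltnW h') eC); apply: pB; rewrite nj ltnW.
  have mq : (m < q)%N by lia.
  have nq : (n < q)%N by exact: ltn_trans nm mq.
  have eEm : restr E m = restr C m by apply: restr_eq_le eE; lia.
  exists (E, q); split => /=.
  - split=> //=; by rewrite (restr_eq_le (ltnW nm) eEm) (restr_eq_le (ltnW nm) eC).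
  - by rewrite eEm.
  - by [].
  - split=> // X eX; apply: hl.
    have lm : (l <= maxn l m.+1)%N by exact: leq_maxl.
    have lq' : (l <= q)%N by exact: leq_trans lm (ltnW lq).
    by rewrite (restr_eq_le lq' eX) (restr_eq_le lm eE).
have GL : (\bigcap_i F i) L.
  by move=> k _; have [h _] := Ps k; apply: h; exact: Ls.
have := GR L GL (bet (greedy a)) id (martingale_bet _)
  (computable_bet (comp_greedy ca)) order_id comp_id.
move=> /not_success_setP[N [r K]].
(* Stage [N] ends at a length beyond [N] where the bet has ratio at least 1, against the bound
   r/(r+1). *)
have [_] := Ps N; rewrite leNgt => /negP; apply; rewrite -Ls.
apply: le_lt_trans (K _ _) _; first by apply: leq_trans (les _); exact: leqnSn.
by rewrite ltr_pdivrMr ?ltr0n // mul1r ltr_nat.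
Qed.

(** * Listing the computable martingales and the diagonal construction *)

Lemma computable_martingale_enum : exists e : nat -> seq bool -> R,
  (forall i, martingale (e i) /\ computable_real_fun (e i)) /\
  forall d, martingale d -> computable_real_fun d -> exists i, e i = d.
Proof.
(* A program approximates at most one martingale, so programs can serve as indices; the remaining
   indices get the zero martingale. *)
pose idx i d := [/\ martingale d, computable_real_fun d &
  exists2 a, approx d a & forall x, halts_to i x (a x)].
have idx_uniq i d d' : idx i d -> idx i d' -> d = d'.
  move=> [_ _ [a da ia]] [_ _ [a' da' ia']].
  have aa' x : a x = a' x by have [t h] := ia x; have [t' h'] := ia' x; exact: out_fun h h'.
  by apply/funext => w; apply/eqP; rewrite eq_le; apply/andP; split;
    apply: (@le_pow2_limit _ _ _ 4) => n;
    have [h1 h2] := approxP w n da; have [h3 h4] := approxP w n da'; rewrite -aa' in h3 h4; lra.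
have m0 : martingale (fun=> 0 : R) by split=> // w; rewrite mulr0 addr0.
have c0 : computable_real_fun (fun=> 0 : R).
  apply/computable_real_approx; exists (fun=> 0%N); first exact: comp_const.
  by move=> w n; rewrite mulr0 subrr normr0.
have /choice[e he] : forall i, exists d, (martingale d /\ computable_real_fun d) /\
    forall d', idx i d' -> d = d'.
  move=> i; have [[d hd]|nd] := pselect (exists d, idx i d).
    by exists d; split=> [|d']; [case: hd|exact: idx_uniq].
  by exists (fun=> 0); split=> // d' hd'; case: nd; exists d'.
exists e; split=> [i|d dm dc]; first by case: (he i).
have /computable_real_approx[a [c hc] da] := dc.
exists (gn c); apply: (he _).2; split=> //; exists a => // x.
exact: reval_halts.
Qed.

Lemma martingale_add d D (c : R) : 0 <= c -> martingale d -> martingale D ->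
  martingale (fun w => D w + c * d w).
Proof.
move=> c0 [d0 dm] [D0 Dm]; split=> w; first by rewrite addr_ge0 // mulr_ge0.
have := dm w; have := Dm w => e e'.
by rewrite mulrDr e mulrCA e'; ring.
Qed.

Lemma computable_add d D x : computable_real_fun d -> computable_real_fun D ->
  computable_real_fun (fun w => D w + 2 ^- x * d w).
Proof.
move=> /computable_real_approx[a ca da] /computable_real_approx[b cb Db].
apply/computable_real_approx.
(* Three extra bits: the errors 2 from [b], at most 2 from the scaled [a] and 1 from rounding shrink
   below 1 after division by 8, leaving 1 for the last rounding. *)
exists (fun z => (b (npair (un1 z) (un2 z + 3)) +
                  a (npair (un1 z) (un2 z + 3)) %/ ((2 ^ x).-1).+1) %/ 7.+1)%N.
  by comp.
move=> w n; rewrite !unK.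
have [h1 h2] := approxP w (n + 3)%N da; have [h3 h4] := approxP w (n + 3)%N Db.
move: (a _) (b _) h1 h2 h3 h4 => u v h1 h2 h3 h4; have P := pow2_gt0 (R := R) x.
have := natdiv_bounds (R := R) u (2 ^ x).-1; rewrite prednK ?expn_gt0 // natrX.
move: (u %/ _)%N => q [k1 k2].
have := natdiv_bounds (R := R) (v + q) 7; move: (_ %/ _)%N => y; rewrite natrD => -[l1 l2].
have z0 : 0 < 2 ^- x :> R by rewrite invr_gt0.
have z1 : 2 ^- x <= 1 :> R by rewrite invf_le1 // exprn_ege1 // ler1n.
have e8 : 2 ^+ (n + 3) = 8 * 2 ^+ n :> R by rewrite exprD mulrC -(natrX _ 2 3).
rewrite e8 in h1 h2 h3 h4.
have {}h1 := ler_wpM2r (ltW z0) h1; have {}h2 := ler_wpM2r (ltW z0) h2.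
rewrite ler_pdivlMr // in l1; rewrite ler_pdivrMr // in l2.
move: {P} (2 ^- x) z0 z1 h1 h2 k1 k2 => z z0 z1 h1 h2 k1 k2.
rewrite mulrDr (mulrCA _ z).
move: (2 ^+ n) h1 h2 h3 h4 => p; rewrite !mulrDl -!mulrA (mulrC (d w) z) (mulrCA p z).
move: (p * d w) (p * D w) => X Y h1 h2 h3 h4.
by rewrite ler_norml; apply/andP; split; lra.
Qed.

Lemma not_boldface_Sigma03_schnorr_random : ~ boldface_Sigma03 (schnorr_random R).
Proof.
move=> [G dG RG]; have [e [he e_surj]] := computable_martingale_enum.
pose I (s : cantor_space * nat * (seq bool -> R)) :=
  [/\ martingale s.2, computable_real_fun s.2 & potential s.2 (restr s.1.1 s.1.2) < 1].
pose P k (s s' : cantor_space * nat * (seq bool -> R)) :=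
  [/\ forall m, (s.1.2 <= m <= s'.1.2)%N -> potential s.2 (restr s'.1.1 m) < 1,
  forall C, restr C s'.1.2 = restr s'.1.1 s'.1.2 ->
    (forall m, (s'.1.2 <= m)%N -> potential s.2 (restr C m) < 1) -> ~ G k C,
  forall w, s.2 w <= s'.2 w &
  (exists2 c, 0 < c & forall w, c * e k w <= s'.2 w)].
(* Length 1 is needed: at the empty string the potential of 0 equals 1. *)
have I0 : I (point, 1%N, fun=> 0).
  split=> /=.
  - by split=> // w; rewrite mulr0 addr0.
  - apply/computable_real_approx; exists (fun=> 0%N); first exact: comp_const.
    by move=> w n; rewrite mulr0 subrr normr0.
  - by rewrite /potential add0r size_restr expr1 invf_lt1 // ltr1n.
have [|s [L [Is Ps les lts Ls]]] := @chain_limit _ (fun s => s.1.1) (fun s => s.1.2) I P _ I0.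
  move=> k [[A n] D] [/= Dm Dc pA].
  have GR : G k `<=` schnorr_random R by rewrite RG => C GC; exists k.
  have [B [m [nm eB pB aB]]] := Gdelta_avoid (dG k) GR Dm Dc pA.
  have [em ec] := he k.
  have gap : 0 < 1 - potential D (restr B m) by rewrite subr_gt0 pB // leqnn ltnW.
  (* Chosen so that [2 ^- x * e k] stays below the gap left under 1 at the new prefix. *)
  set x := Num.bound (e k (restr B m) / (1 - potential D (restr B m))).
  have hx : e k (restr B m) / (1 - potential D (restr B m)) < 2 ^+ x.
    by apply: lt_trans (ltr_pow2 x); apply: archi_boundP; rewrite divr_ge0 ?em.1 // ltW.
  have P0 := pow2_gt0 (R := R) x.
  exists (B, m, fun w => D w + 2 ^- x * e k w); split=> //=.
  - split=> /=; [|exact: computable_add|].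
      by apply: martingale_add => //; rewrite invr_ge0 ltW.
    rewrite ltr_pdivrMr // -ltr_pdivrMl // in hx.
    by rewrite /potential in hx *; lra.
  - split=> //= [w|]; first by rewrite lerDl mulr_ge0 ?em.1 // invr_ge0 ltW.
    exists (2 ^- x) => [|w]; first by rewrite invr_gt0.
    by rewrite lerDr Dm.1.
have mono k j w : (s k).2 w <= (s (j + k)%N).2 w.
  elim: j => // j IH; apply: le_trans IH _.
  by have [_ _ h _] := Ps (j + k)%N; exact: h.
(* Each stretch of [L] is controlled by the sum current at its stage, which dominates all earlier
   ones. *)
have bnd k m : ((s k).1.2 <= m)%N -> potential (s k).2 (restr L m) < 1.
  move=> km; have H j : (m <= (s (j + k)%N).1.2)%N -> potential (s k).2 (restr L m) < 1.
    elim: j => [mk|j IH mj].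
      have -> : m = (s k).1.2 by apply/eqP; rewrite eqn_leq mk.
      by rewrite Ls; have [] := Is k.
    have [/IH//|/ltnW jm] := leqP m (s (j + k)%N).1.2.
    have [h _ _ _] := Ps (j + k)%N; have := h m; rewrite jm => /(_ mj).
    rewrite -(restr_eq_le mj (Ls _)); apply: le_lt_trans.
    by rewrite /potential lerD2r mono.
  by apply: (H m); apply: leq_trans (les _); rewrite leq_addr.
have : schnorr_random R L.
  move=> d h dm dc [hh hub] ch; apply/not_success_setP.
  have [k ek] := e_surj d dm dc.
  have [_ _ _ [c c0 hc]] := Ps k.
  (* As c d < 1 along [L] and h(n) > 2/c from [M] on, the ratio is at most 1/2, which is r/(r+1) for
     r = 1. *)
  have [M hM] := hub (Num.bound (2 / c)).
  exists (maxn M (s k.+1).1.2), 1%N => n; rewrite geq_max => /andP[Mn sn].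
  have := bnd k.+1 n sn; have := hc (restr L n); rewrite ek /potential => h1 h2.
  have P0 := pow2_gt0 (R := R) (size (restr L n)).
  have h3 : c * d (restr L n) < 1 by move: P0; rewrite -invr_gt0; lra.
  have h4 : 2 / c < (h n)%:R.
    apply: (@lt_trans _ _ (Num.bound (2 / c))%:R).
      by apply: archi_boundP; rewrite divr_ge0 // ltW.
    by rewrite ltr_nat; apply: leq_trans hM (hh _ _ Mn).
  have hn0 : 0 < (h n)%:R :> R by apply: le_lt_trans h4; rewrite divr_ge0 // ltW.
  rewrite ltr_pdivrMr // in h4.
  rewrite ler_pdivrMr // -(ler_pM2l c0); lra.
(* Stage [k] excludes [G k] for sequences keeping the potential of the old sum below 1, and [bnd]
   shows this for [L]. *)
rewrite RG => -[k _]; have [_ av _ _] := Ps k; apply: (av L (Ls _)) => m km.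
by apply: bnd; apply: leq_trans km; exact: ltnW (lts k).
Qed.

End NotSigma03.

Theorem mainTheorem16 (R : realType) :
  lightface_Pi03 (schnorr_random R) /\ ~ boldface_Sigma03 (schnorr_random R).
Proof.
split; first exact: lightface_Pi03_schnorr_random.
exact: not_boldface_Sigma03_schnorr_random.
Qed.
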